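(* Let $\mathcal{H}$ be a Hilbert space of finite dimension $d$ with fixed computational basis $\{|j\rangle\}_{j=1}^d$, and let $f_1=|f_1\rangle\langle f_1|$ with $|f_1\rangle=\frac{1}{\sqrt d}\sum_{j=1}^d|j\rangle$. For any density matrix $\rho$ on $\mathcal{H}$, $$1-\sqrt{1-\mathcal{T}_{\mathrm{F}}(\rho)}\leqslant\mathcal{T}_{\operatorname{Tr}}(\rho)\leqslant\sqrt{\mathcal{T}_{\mathrm{F}}(\rho)}.$$
   Context: A density matrix is a positive semidefinite operator of trace one. The fidelity-based texture measure is $\mathcal{T}_{\mathrm{F}}(\rho)=1-\langle f_1|\rho|f_1\rangle$. The trace-norm texture measure is $\mathcal{T}_{\operatorname{Tr}}(\rho)=\frac12\|\rho-f_1\|_{\operatorname{Tr}}$, where $\|A\|_{\operatorname{Tr}}=\operatorname{Tr}\sqrt{A^\dagger A}$. *)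

(* Defs.v *)
From HB Require Import structures.
From mathcomp Require Import all_boot all_order all_algebra.
From mathcomp Require Import sesquilinear spectral.
From mathcomp Require Export reals complex.

Set Implicit Arguments.
Unset Strict Implicit.
Unset Printing Implicit Defensive.

Import Order.TTheory GRing.Theory Num.Theory Num.Def.

Local Open Scope ring_scope.
Local Open Scope sesquilinear_scope.

(* The Hilbert space with its orthonormal computational basis is C^d: kets are
   column vectors, operators are matrices acting on the left of them, and
   [M ^t*] is the adjoint.  The basis is indexed by 0, ..., d-1. *)

Section Definitions.
Context {C : numClosedFieldType}.

(* [0 <= z] in [C] means that z is a nonnegative real number. *)
Definition psdmx {d} (A : 'M[C]_d) : Prop :=
  A \is hermsymmx /\ forall v : 'cV[C]_d, 0 <= (v ^t* *m A *m v) 0 0.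

Definition density_matrix {d} (rho : 'M[C]_d) : Prop :=
  psdmx rho /\ \tr rho = 1.

(* Square root by functional calculus: a normal matrix A is
   [invmx P *m diag_mx D *m P], with P = spectralmx A unitary and
   D = spectral_diag A.  The value is meaningful only for A positive
   semidefinite; see [sqrtmx_psd], [sqrtmx_sqr] and [sqrtmx_uniq]. *)
Definition sqrtmx {d} (A : 'M[C]_d) : 'M[C]_d :=
  invmx (spectralmx A) *m diag_mx (map_mx sqrtC (spectral_diag A))
    *m spectralmx A.

Definition trace_norm {d} (A : 'M[C]_d) : C := \tr (sqrtmx (A ^t* *m A)).

Definition ket {d} (j : 'I_d) : 'cV[C]_d := delta_mx j 0.

Definition ket_f1 d : 'cV[C]_d := (sqrtC d%:R)^-1 *: \sum_(j < d) ket j.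

Definition f1 d : 'M[C]_d := ket_f1 d *m (ket_f1 d) ^t*.

(* The textures are complex numbers, which are real for a density matrix; see
   [texture_F_real] and [texture_Tr_ge0]. *)
Definition texture_F {d} (rho : 'M[C]_d) : C :=
  1 - ((ket_f1 d) ^t* *m rho *m ket_f1 d) 0 0.

Definition texture_Tr {d} (rho : 'M[C]_d) : C :=
  2^-1 * trace_norm (rho - f1 d).

End Definitions.

Section SquareRoot.
Context {C : numClosedFieldType} {d : nat}.
Implicit Types A B : 'M[C]_d.

Lemma adjmxM m n p (A : 'M[C]_(m, n)) (B : 'M[C]_(n, p)) :
  (A *m B) ^t* = B ^t* *m A ^t*.
Proof. by rewrite trmx_mul map_mxM. Qed.

Lemma hermE A : (A \is hermsymmx) = (A == A ^t*).
Proof. by rewrite qualifE /= expr0 scale1r. Qed.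

Lemma psd_adjmul A : psdmx (A ^t* *m A).
Proof.
split; first by rewrite hermE adjmxM trmxCK.
move=> v; rewrite !mulmxA -adjmxM -mulmxA mxE sumr_ge0 // => i _.
by rewrite !mxE mulrC mul_conjC_ge0.
Qed.

Lemma psd_spectral A : psdmx A ->
  A = (spectralmx A) ^t* *m diag_mx (spectral_diag A) *m spectralmx A.
Proof.
case=> hA _; rewrite -invmx_unitary ?spectral_unitarymx //.
apply/orthomx_spectralP; exact: hermitian_normalmx.
Qed.

Lemma psd_spectral_ge0 A i : psdmx A -> 0 <= spectral_diag A 0 i.
Proof.
move=> pA; have eA := psd_spectral pA.
set v : 'cV[C]_d := delta_mx i 0.
case: (pA) => _ /(_ ((spectralmx A) ^t* *m v)).
have /unitarymxP uP := spectral_unitarymx A.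
set P := spectralmx A in eA uP *; set D := spectral_diag A in eA *.
have -> : (P ^t* *m v) ^t* *m A *m (P ^t* *m v) =
  v ^t* *m (P *m P ^t*) *m diag_mx D *m (P *m P ^t*) *m v.
  by rewrite adjmxM trmxCK {1}eA !mulmxA.
rewrite uP !mulmx1 /v trmx_delta map_delta_mx -rowE -colE.
by rewrite !mxE eqxx mulr1n.
Qed.

Lemma sqrtmxE A :
  sqrtmx A = (spectralmx A) ^t* *m diag_mx (map_mx sqrtC (spectral_diag A))
               *m spectralmx A.
Proof. by rewrite /sqrtmx invmx_unitary // spectral_unitarymx. Qed.

Lemma sqrtmx_sqr A : psdmx A -> sqrtmx A *m sqrtmx A = A.
Proof.
move=> pA; rewrite {3}(psd_spectral pA) sqrtmxE.
have /unitarymxP uP := spectral_unitarymx A.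
set P := spectralmx A in uP *; set D := spectral_diag A.
rewrite !mulmxA -[_ *m P *m P ^t*]mulmxA uP mulmx1 -[X in X *m P]mulmxA mulmx_diag.
congr (_ *m diag_mx _ *m _); apply/rowP => i.
by rewrite !mxE -expr2 sqrtCK.
Qed.

Lemma psd_conj A B : psdmx A -> psdmx (B ^t* *m A *m B).
Proof.
case=> /[!hermE]/eqP hA pA; split.
  by rewrite hermE !adjmxM trmxCK -hA mulmxA.
by move=> v; move: (pA (B *m v)); rewrite adjmxM !mulmxA.
Qed.

Lemma psd_diag (D : 'rV[C]_d) : (forall i, 0 <= D 0 i) -> psdmx (diag_mx D).
Proof.
move=> D0; split.
  rewrite hermE; apply/eqP/matrixP => i j; rewrite !mxE eq_sym.
  case: eqP => [->|_]; rewrite ?mulr0n ?conjC0 // mulr1n.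
  by rewrite geC0_conj.
move=> v; rewrite mxE sumr_ge0 // => i _.
rewrite mul_mx_diag !mxE mulrAC mulr_ge0 // mulrC; exact: mul_conjC_ge0.
Qed.

Lemma sqrtmx_psd A : psdmx A -> psdmx (sqrtmx A).
Proof.
move=> pA; rewrite sqrtmxE; apply/psd_conj/psd_diag => i.
by rewrite mxE sqrtC_ge0 psd_spectral_ge0.
Qed.

Lemma sqrtmx_uniq A B : psdmx B -> B *m B = A -> B = sqrtmx A.
Proof.
move=> pB eBA; have pA : psdmx A.
  by have := psd_adjmul B; rewrite -eBA; case: pB => /[!hermE]/eqP <-.
have eB := psd_spectral pB; have eA := psd_spectral pA.
have E0 i := psd_spectral_ge0 i pB; have D0 i := psd_spectral_ge0 i pA.
rewrite sqrtmxE.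
have /unitarymxP uP := spectral_unitarymx A.
have /unitarymxP uQ := spectral_unitarymx B.
move: uP uQ eA eB D0 E0.
set P := spectralmx A; set D := spectral_diag A.
set Q := spectralmx B; set E := spectral_diag B => uP uQ eA eB D0 E0.
have uP' := mulmx1C uP; have uQ' := mulmx1C uQ.
set S := map_mx sqrtC D; set W := P *m Q ^t*.
have eW : W *m (diag_mx E *m diag_mx E) = diag_mx D *m W.
  transitivity (P *m A *m Q ^t*).
    rewrite -eBA {1 2}eB /W !mulmxA -[_ *m Q *m Q ^t*]mulmxA uQ mulmx1.
    by rewrite -[_ *m Q *m Q ^t*]mulmxA uQ mulmx1.
  by rewrite {1}eA /W !mulmxA uP mul1mx.
have eWS : W *m diag_mx E = diag_mx S *m W.
  apply/matrixP => i j; move/matrixP/(_ i j): eW.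
  rewrite mulmx_diag !mul_mx_diag !mul_diag_mx !mxE.
  set w := \sum_(_ < _) _; have d0 := D0 i; have e0 := E0 j.
  have s0 : 0 <= sqrtC (D 0 i) by rewrite sqrtC_ge0.
  rewrite -[D 0 i in RHS]sqrtCK expr2 => h.
  have /eqP : w * ((E 0 j - sqrtC (D 0 i)) * (E 0 j + sqrtC (D 0 i))) = 0.
    by rewrite -subr_sqr mulrBr !expr2 h mulrC subrr.
  rewrite !mulf_eq0 => /or3P[/eqP->||]; first by rewrite mul0r mulr0.
    by rewrite subr_eq0 => /eqP->; rewrite mulrC.
  by rewrite paddr_eq0 // => /andP[/eqP-> /eqP->]; rewrite mul0r mulr0.
rewrite {1}eB -[X in X *m _ *m Q]mul1mx -uP' -2!mulmxA -/P.
rewrite -[P ^t* *m diag_mx S *m P]mulmxA -[P ^t* *m P *m _]mulmxA.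
congr (_ *m _); rewrite [P *m _]mulmxA -/W.
by rewrite mulmxA eWS /W -!mulmxA uQ' mulmx1.
Qed.

End SquareRoot.

Section Textures.
Context {C : numClosedFieldType} {d : nat}.
Implicit Types A rho : 'M[C]_d.

Lemma trace_norm_ge0 A : 0 <= trace_norm A.
Proof.
have [_ pS] := sqrtmx_psd (psd_adjmul A).
rewrite /trace_norm /mxtrace sumr_ge0 // => i _.
have := pS (ket i).
by rewrite /ket trmx_delta map_delta_mx -rowE -colE !mxE.
Qed.

Lemma texture_Tr_ge0 rho : 0 <= texture_Tr rho.
Proof. by rewrite mulr_ge0 ?trace_norm_ge0 // invr_ge0 ler0n. Qed.

Lemma texture_F_real rho : density_matrix rho -> texture_F rho \is Num.real.
Proof. by case=> -[_ p] _; rewrite rpredB ?ger0_real. Qed.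

End Textures.

(* Main.v *)
Require Import Defs.
From mathcomp Require Import all_boot all_order all_algebra.
From mathcomp Require Import reals complex.
From mathcomp Require Import sesquilinear spectral ring.

(* In an orthonormal eigenbasis of [rho - f1], let a and b be the diagonals of
   f1 and rho: two probability vectors, whose difference lists the eigenvalues,
   so that T_Tr is the total variation distance (1/2) sum |b_i - a_i|.

   Lower bound: T_F = tr (f1 (f1 - rho)) = sum a_i (a_i - b_i) <= T_Tr because
   0 <= a_i <= 1, and 1 - sqrt (1 - T_F) <= T_F.

   Upper bound: the entries of rho satisfy |rho_ij| <= sqrt (b_i b_j), hence
   sqrt (1 - T_F) <= B with B = sum sqrt (a_i b_i); and factoring a_i - b_i as
   a difference of squares of square roots, Cauchy-Schwarz gives
   T_Tr ^ 2 <= 1 - B ^ 2 <= T_F. *)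

Import Order.TTheory GRing.Theory Num.Theory Num.Def.
Local Open Scope ring_scope.
Local Open Scope sesquilinear_scope.

(** Cauchy-Schwarz for [dotmx], whose conjugation disappears on real families. *)
Lemma sum_mul_sqr_le (C : numClosedFieldType) (n : nat) (x y : 'I_n -> C) :
  (forall i, x i \is Num.real) -> (forall i, y i \is Num.real) ->
  (\sum_i x i * y i) ^+ 2 <= (\sum_i x i ^+ 2) * (\sum_i y i ^+ 2).
Proof.
move=> xR yR.
have dotE (u v : 'I_n -> C) : (forall i, v i \is Num.real) ->
    dotmx (\row_i u i) (\row_i v i) = \sum_i u i * v i.
  move=> vR; rewrite dotmxE mxE; apply: eq_bigr => i _.
  by rewrite !mxE conj_Creal.
have : `|dotmx (\row_i x i) (\row_i y i)| ^+ 2 <=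
    dotmx (\row_i x i) (\row_i x i) * dotmx (\row_i y i) (\row_i y i).
  exact: (CauchySchwarz (@dotmx C n) _ _).1.
rewrite !dotE // real_normK; last by apply: rpred_sum => i _; rewrite rpredM.
under [X in X * _]eq_bigr => i _ do rewrite -expr2.
by under [X in _ * X]eq_bigr => i _ do rewrite -expr2.
Qed.

Lemma total_variation_sqr_le (C : numClosedFieldType) (n : nat)
    (x y : 'I_n -> C) :
  (forall i, 0 <= x i) -> (forall i, 0 <= y i) ->
  \sum_i x i ^+ 2 = 1 -> \sum_i y i ^+ 2 = 1 ->
  (\sum_i `|x i ^+ 2 - y i ^+ 2|) ^+ 2 <= 4 * (1 - (\sum_i x i * y i) ^+ 2).
Proof.
move=> x0 y0 x1 y1; set s := \sum_i x i * y i.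
have xyR i : x i - y i \is Num.real by rewrite rpredB ?ger0_real.
have -> : \sum_i `|x i ^+ 2 - y i ^+ 2| = \sum_i `|x i - y i| * (x i + y i).
  apply: eq_bigr => i _; rewrite subr_sqr normrM.
  by rewrite [X in _ * X = _]ger0_norm ?addr_ge0.
(* Since [x] and [y] are unit vectors, the two factors are 2 - 2s and 2 + 2s. *)
have -> : 4 * (1 - s ^+ 2) =
    (\sum_i `|x i - y i| ^+ 2) * (\sum_i (x i + y i) ^+ 2).
  under eq_bigr => i _ do rewrite real_normK // sqrrB.
  under [X in _ = _ * X]eq_bigr => i _ do rewrite sqrrD.
  by rewrite !big_split /= sumrN !sumrMnl x1 y1 -/s; ring.
by apply: sum_mul_sqr_le => i; rewrite ?normr_real // rpredD ?ger0_real.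
Qed.

Lemma sum_mul_subr_le (C : numClosedFieldType) (n : nat) (a b : 'I_n -> C) :
  (forall i, 0 <= a i <= 1) -> (forall i, b i \is Num.real) ->
  \sum_i a i = \sum_i b i ->
  \sum_i a i * (a i - b i) <= 2^-1 * \sum_i `|b i - a i|.
Proof.
move=> a01 bR eab.
(* The differences [a i - b i] sum to zero, so adding them is free and turns each summand into the
   positive part of [a i - b i]. *)
have -> : 2^-1 * \sum_i `|b i - a i| =
    \sum_i 2^-1 * (`|b i - a i| + (a i - b i)).
  by rewrite -mulr_sumr big_split /= sumrB eab subrr addr0.
apply: ler_sum => i _; case/andP: (a01 i) => a0 a1.
have dR : a i - b i \is Num.real by rewrite rpredB ?bR ?(ger0_real a0).
rewrite distrC; case: (real_ge0P dR) => d0.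
  rewrite -[X in 2^-1 * X]mulr2n -[X in 2^-1 * X]mulr_natl.
  by rewrite mulKf ?pnatr_eq0 // ler_piMl.
by rewrite addNr mulr0 mulr_ge0_le0 // ltW.
Qed.

(** Replacing the eigenvalues of [A] by their absolute values gives a positive semidefinite matrix
    with the square of [A]; by uniqueness it is the square root in the trace norm. *)
Lemma trace_norm_herm (C : numClosedFieldType) (d : nat) (A : 'M[C]_d) :
  A \is hermsymmx -> trace_norm A = \sum_i `|spectral_diag A 0 i|.
Proof.
move=> hA; have /orthomx_spectralP := hermitian_normalmx hA.
rewrite invmx_unitary ?spectral_unitarymx //.
have /unitarymxP uP := spectral_unitarymx A.
have /mxOverP DR := hermitian_spectral_diag_real hA.
move: uP DR; set P := spectralmx A; set D := spectral_diag A => uP DR eA.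
set E : 'rV[C]_d := map_mx normr D.
rewrite /trace_norm -(@sqrtmx_uniq _ _ _ (P ^t* *m diag_mx E *m P)).
- rewrite mxtrace_mulC mulmxA uP mul1mx mxtrace_diag.
  by apply: eq_bigr => i _; rewrite mxE.
- by apply/psd_conj/psd_diag => i; rewrite mxE.
move: hA; rewrite hermE => /eqP <-; rewrite eA.
rewrite !mulmxA -[_ *m P *m P ^t*]mulmxA uP mulmx1.
rewrite -[_ *m P *m P ^t*]mulmxA uP mulmx1.
rewrite -[X in X *m P = _]mulmxA -[X in _ = X *m P]mulmxA !mulmx_diag.
congr (_ *m diag_mx _ *m _); apply/rowP => i.
by rewrite !mxE -!expr2 real_normK.
Qed.

(** [S] is the Gram matrix of the rows of its square root, so this is Cauchy-Schwarz for two
    rows. *)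
Lemma psd_entry_le (C : numClosedFieldType) (d : nat) (S : 'M[C]_d) i j :
  psdmx S -> `|S i j| <= sqrtC (S i i) * sqrtC (S j j).
Proof.
move=> pS; have [hB _] := sqrtmx_psd pS; rewrite hermE in hB.
have dotE k l : S k l = dotmx (row k (sqrtmx S)) (row l (sqrtmx S)).
  rewrite dotmxE -{1}(sqrtmx_sqr pS) {2}(eqP hB) !mxE.
  by apply: eq_bigr => m _; rewrite !mxE.
by rewrite !dotE; apply: (CauchySchwarz_sqrt (@dotmx C d) _ _).1.
Qed.

Lemma psd_quad_le (C : numClosedFieldType) (d : nat) (S : 'M[C]_d)
    (v : 'cV[C]_d) : psdmx S ->
  (v ^t* *m S *m v) 0 0 <= (\sum_i `|v i 0| * sqrtC (S i i)) ^+ 2.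
Proof.
move=> pS; rewrite -[leLHS]ger0_norm; last by case: pS.
rewrite expr2 mulr_suml mxE.
under eq_bigr => j _ do rewrite mxE mulr_suml.
rewrite exchange_big /=; apply: le_trans (ler_norm_sum _ _ _) _.
apply: ler_sum => i _; rewrite mulr_sumr.
apply: le_trans (ler_norm_sum _ _ _) _; apply: ler_sum => j _.
rewrite !normrM !mxE norm_conjC -!mulrA ler_wpM2l //.
by rewrite mulrC mulrCA ler_wpM2l // psd_entry_le.
Qed.

(** The situation after passing to an eigenbasis: [S] is the state, [h] the pure state and [D] lists
    the eigenvalues of their difference. *)
Lemma diag_rank1_fidelity (C : numClosedFieldType) (d : nat) (S : 'M[C]_d)
    (h : 'cV[C]_d) (D : 'rV[C]_d) (t := 2^-1 * \sum_i `|D 0 i|)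
    (p := (h ^t* *m S *m h) 0 0) :
  psdmx S -> \tr S = 1 -> (h ^t* *m h) 0 0 = 1 ->
  S = diag_mx D + h *m h ^t* ->
  1 - p <= t /\ t ^+ 2 <= 1 - p.
Proof.
move=> pS trS h1 eS.
have Sii0 i : 0 <= S i i.
  case: pS => _ /(_ (delta_mx i 0)).
  by rewrite trmx_delta map_delta_mx -rowE -colE !mxE.
have DE i : D 0 i = S i i - `|h i 0| ^+ 2.
  by rewrite eS !mxE big_ord1 !mxE eqxx mulr1n -normCK addrK.
have tE : t = 2^-1 * \sum_i `|S i i - `|h i 0| ^+ 2|.
  by rewrite /t; under eq_bigr => i _ do rewrite DE.
have a1 : \sum_i `|h i 0| ^+ 2 = 1.
  by rewrite -h1 mxE; apply: eq_bigr => i _; rewrite !mxE normCKC.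
split.
  (* As [h] is a unit vector, the rank-one part of [S] contributes exactly 1 to [p]; hence 1 - p is
     minus the quadratic form of [diag_mx D] at [h]. *)
  rewrite tE; suff -> : 1 - p = \sum_i `|h i 0| ^+ 2 * (`|h i 0| ^+ 2 - S i i).
    apply: sum_mul_subr_le => [i|i|]; last by rewrite a1 -trS.
      by rewrite exprn_ge0 //= -a1 (bigD1 i) //= lerDl sumr_ge0 // => j _;
         rewrite exprn_ge0.
    exact: ger0_real.
  have hh : h ^t* *m h = 1%:M by rewrite [LHS]mx11_scalar h1.
  rewrite /p {1}eS mulmxDr mulmxDl !mulmxA hh mul1mx hh.
  rewrite [X in 1 - X]mxE [1%:M 0 0]mxE opprD addrCA subrr addr0 mxE -sumrN.
  apply: eq_bigr => i _; rewrite mul_mx_diag !mxE DE -opprB mulrN.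
  by rewrite normCK; ring.
have := @total_variation_sqr_le C d (fun i => `|h i 0|)
  (fun i => sqrtC (S i i)).
move=> /(_ (fun=> normr_ge0 _)) TV.
have {TV}: (2 * t) ^+ 2 <= 4 * (1 - (\sum_i `|h i 0| * sqrtC (S i i)) ^+ 2).
  rewrite tE mulrA mulfV ?pnatr_eq0 // mul1r.
  under eq_bigr => i _ do rewrite distrC -{1}[S i i]sqrtCK.
  apply: TV => // [i|]; first by rewrite sqrtC_ge0.
  by rewrite -trS; apply: eq_bigr => i _; rewrite sqrtCK.
rewrite exprMn -natrX ler_pM2l ?ltr0n // => /le_trans; apply.
by rewrite lerB // psd_quad_le.
Qed.

(** Conjugation by the unitary that diagonalizes the difference preserves [p], the trace and the
    norm of [g], which reduces the claim to [diag_rank1_fidelity]. *)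
Lemma pure_trace_distance (C : numClosedFieldType) (d : nat) (rho : 'M[C]_d)
    (g : 'cV[C]_d) (t := 2^-1 * trace_norm (rho - g *m g ^t*))
    (p := (g ^t* *m rho *m g) 0 0) :
  density_matrix rho -> (g ^t* *m g) 0 0 = 1 ->
  1 - p <= t /\ t ^+ 2 <= 1 - p.
Proof.
case=> prho tr1 g1; have hrho : rho ^t* = rho.
  by apply/esym/eqP; rewrite -hermE; case: prho.
rewrite /t; set A := rho - _.
have hA : A \is hermsymmx.
  rewrite hermE /A; apply/eqP.
  by rewrite linearB /= map_mxB hrho adjmxM trmxCK.
rewrite trace_norm_herm //.
have /orthomx_spectralP := hermitian_normalmx hA.
rewrite invmx_unitary ?spectral_unitarymx //.
have /unitarymxP uP := spectral_unitarymx A.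
move: uP; set P := spectralmx A; set D := spectral_diag A => uP eA.
have uP' := mulmx1C uP.
have pE : p = ((P *m g) ^t* *m (P *m rho *m P ^t*) *m (P *m g)) 0 0.
  rewrite adjmxM !mulmxA -[g ^t* *m _ *m P]mulmxA uP' mulmx1.
  by rewrite -[_ *m P ^t* *m P]mulmxA uP' mulmx1.
rewrite pE; apply: diag_rank1_fidelity.
- by have := psd_conj (P ^t*) prho; rewrite trmxCK.
- by rewrite mxtrace_mulC mulmxA uP' mul1mx.
- by rewrite adjmxM mulmxA -[_ *m P ^t* *m P]mulmxA uP' mulmx1.
have -> : rho = A + g *m g ^t* by rewrite subrK.
rewrite mulmxDr mulmxDl eA adjmxM !mulmxA uP mul1mx.
by rewrite -[_ *m P *m P ^t*]mulmxA uP mulmx1.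
Qed.

Lemma ket_f1_unit (C : numClosedFieldType) (d : nat) :
  (0 < d)%N -> ((@ket_f1 C d) ^t* *m ket_f1 d) 0 0 = 1.
Proof.
move=> d0; have d0C : 0 <= (d%:R : C) by rewrite ler0n.
have kE i : ket_f1 d i 0 = (sqrtC d%:R)^-1 :> C.
  rewrite mxE summxE (bigD1 i) //= big1 => [|j /negPf ji].
    by rewrite mxE !eqxx addr0 mulr1.
  by rewrite mxE eq_sym ji.
have adjE i : (ket_f1 d) ^t* 0 i = (sqrtC d%:R)^-1 :> C.
  by rewrite mxE [_ 0 i]mxE kE geC0_conj ?invr_ge0 ?sqrtC_ge0.
rewrite mxE; under eq_bigr => i _ do rewrite adjE kE -expr2 exprVn sqrtCK.
rewrite sumr_const card_ord -[X in X *+ _]mulr1 -mulrnAr.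
by rewrite mulVf // pnatr_eq0 -lt0n.
Qed.

Theorem proposition5 (R : realType) (d : nat) (rho : 'M[R[i]]_d)
  (hrho : density_matrix rho) :
  1 - sqrtC (1 - texture_F rho) <= texture_Tr rho <= sqrtC (texture_F rho).
Proof.
(* In dimension 0 the trace would be 0 instead of 1. *)
have d0 : (0 < d)%N.
  case: d rho hrho => // rho [_ /eqP].
  by rewrite /mxtrace big_ord0 eq_sym oner_eq0.
have [lb ub] := pure_trace_distance _ _ _ _ hrho (ket_f1_unit _ _ d0).
rewrite -/(f1 d) -/(texture_Tr rho) -/(texture_F rho) in lb ub.
have t0 := texture_Tr_ge0 rho; set F := texture_F rho in lb ub *.
have F0 : 0 <= F by apply: le_trans ub; rewrite exprn_ge0.
have p0 : 0 <= 1 - F by rewrite subKr; case: hrho => -[_ +] _; apply.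
apply/andP; split.
  (* What remains is 1 - F <= sqrt (1 - F), true because 1 - F lies between 0 and 1. *)
  apply: le_trans lb; rewrite lerBlDr addrC -lerBlDr.
  rewrite -{1}[1 - F]sqrtCK expr2 ler_piMl ?sqrtC_ge0 //.
  by rewrite -[leRHS]sqrtC1 ler_sqrtC ?qualifE /= ?ler01 // gerBl.
by rewrite -[leLHS]sqrCK // ler_sqrtC ?qualifE /= ?exprn_ge0.
Qed.
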